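(* Let $n,m\ge 1$, $M\in\mathbb{R}^{n\times m}$, $\eta>0$, and let $a\in\mathbb{R}^n$, $b\in\mathbb{R}^m$ have strictly positive entries with $\sum_{i=1}^n a_i=\sum_{j=1}^m b_j=1$. Let $f:\mathbb{R}^{n+m-1}\to\mathbb{R}$ be the (negative) dual objective of entropic-regularized optimal transport with data $(M,a,b,\eta)$, as defined in the context. Let $S\ge 2$ be a pre-specified integer, and let $\{x_k\}$ be a sequence of iterates in $\mathbb{R}^{n+m-1}$ with initial value $x_0$ such that: (i) for every $k\ge 1$ with $k\neq iS$, $i=1,2,\ldots$, the point $x_k$ is generated by the SPLR algorithm, i.e. it is the output of one SPLR step with current iterate $x_{k-1}$; (ii) for every $k=iS$, $i=1,2,\ldots$, letting $x_k^q$ be the next iterate of $x_{k-1}$ using one SPLR step, and letting $x_k^s$ be an arbitrary point, we set $x_k=x_k^s$ if $f(x_k^s)\le f(x_k^q)$, and $x_k=x_k^q$ otherwise. Then $$\lim_{k\to\infty}\Vert\nabla f(x_k)\Vert=0.$$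
   Context: **Objective.** For $x=(\alpha,\beta_{-m})\in\mathbb{R}^{n+m-1}$ with $\alpha\in\mathbb{R}^n$ and $\beta_{-m}=(\beta_1,\ldots,\beta_{m-1})^T\in\mathbb{R}^{m-1}$, put $\beta_m=0$ and $\beta=(\beta_1,\ldots,\beta_m)^T$. Define $$f(x)=\eta\sum_{i=1}^n\sum_{j=1}^m\exp\{\eta^{-1}(\alpha_i+\beta_j-M_{ij})\}-\alpha^Ta-\beta^Tb .$$ Let $T=T(x)\in\mathbb{R}^{n\times m}$ have entries $T_{ij}=\exp\{(\alpha_i+\beta_j-M_{ij})/\eta\}$, and let $T_{-m}$ be $T$ with its $m$-th column removed. $\mathbf{1}_p$ is the all-ones vector in $\mathbb{R}^p$, $\mathbf{diag}(v)$ is the diagonal matrix with diagonal $v$, and $\Vert\cdot\Vert$ is the Euclidean norm. **Sparsified Hessian.** A sparsification scheme is an index set $\Omega\subseteq\{(i,j):1\le i\le n,\,1\le j\le m-1\}$; it is always assumed that $\Omega\supseteq\Omega^*=\{(i,j): i=1\text{ or }j=1,\ 1\le i\le n,\ 1\le j\le m-1\}$. Given $x$ and $\Omega$, let $T_{-m}^\Omega\in\mathbb{R}^{n\times(m-1)}$ have $(i,j)$ entry $T_{ij}$ if $(i,j)\in\Omega$ and $0$ otherwise, and let $$H_\Omega=\eta^{-1}\begin{bmatrix}\mathbf{diag}(T\mathbf{1}_m)&T_{-m}^\Omega\\(T_{-m}^\Omega)^T&\mathbf{diag}(T_{-m}^T\mathbf{1}_n)\end{bmatrix}.$$ **One step of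 the SPLR (sparse-plus-low-rank quasi-Newton) algorithm.** Fixed constants: $\tau_{\max}>0$, $0<c_1<1/2$, $c_1<c_2<1$. Input: the previous iterate $x^-$ with its gradient $g^-=\nabla f(x^-)$, and the current iterate $x$. The step outputs the next iterate $x^+$ as follows. 1. Set $g=\nabla f(x)$, $s^-=x-x^-$, $y^-=g-g^-$, and $\tau=\min\{\tau_{\max},\Vert g\Vert\}$. 2. Determine a sparsification scheme $\Omega\supseteq\Omega^*$ (it may vary from step to step) and form $H_\Omega$ at $x$. 3. If $(y^-)^Ts^->10^{-6}\Vert y^-\Vert^2$, set $R=\xi uu^T+\zeta vv^T$ with $u=y^-$, $v=(H_\Omega+\tau I)s^-$, $\xi=1/((y^-)^Ts^-)$, $\zeta=-1/(v^Ts^-)$; otherwise set $R=0$. 4. Set $B=H_\Omega+R+\tau I$ and $d=-B^{-1}g$. 5. Output $x^+=x+\gamma d$, where the step size $\gamma>0$ is selected by a line search so that the Wolfe conditions hold: $$f(x^+)\le f(x)+c_1\gamma g^Td,\qquad [\nabla f(x^+)]^Td\ge c_2\,g^Td .$$ When the step is applied with current iterate $x=x_{k-1}$, the previous iterate is $x^-=x_{k-2}$. For $k=1$, the previous iterate $x^-$ is an input of the algorithm on which no particular choice is imposed. *)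

(* Defs.v *)
From HB Require Import structures.
From mathcomp Require Import all_boot all_order all_algebra.
From mathcomp Require Import all_classical all_reals all_analysis.

Set Implicit Arguments.
Unset Strict Implicit.
Unset Printing Implicit Defensive.

Import Order.TTheory GRing.Theory Num.Theory.
Import numFieldNormedType.Exports.

Local Open Scope classical_set_scope.
Local Open Scope ring_scope.

Section Euclidean.
Context {R : realType} {p : nat}.
Implicit Types u v : 'cV[R]_p.

Definition dotv u v : R := \sum_(i < p) u i 0 * v i 0.

(* The norm `|u| that MathComp-Analysis puts on matrices is the sup norm. *)
Definition enorm u : R := Num.sqrt (dotv u u).

Definition gradient (F : 'cV[R]_p -> R) (x : 'cV[R]_p) : 'cV[R]_p :=
  \col_i 'D_(delta_mx i 0) F x.

End Euclidean.

(* The numbers of rows and columns of the cost matrix are n.+1 and m.+1, so   *)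
(* that they are positive and that R^(n.+1 + m.+1 - 1) is 'cV[R]_(n.+1 + m).  *)
Section EntropicOT.
Context {R : realType} {n m : nat}.
Variables (M : 'M[R]_(n.+1, m.+1)) (a : 'cV[R]_n.+1) (b : 'cV[R]_m.+1).
Variable eta : R.
Implicit Types x : 'cV[R]_(n.+1 + m).

Definition ot_alpha x : 'cV[R]_n.+1 := usubmx x.

Definition ot_beta x : 'cV[R]_m.+1 :=
  \col_j (if unlift ord_max j is Some j' then dsubmx x j' 0 else 0).

Definition ot_plan x : 'M[R]_(n.+1, m.+1) :=
  \matrix_(i, j) expR ((ot_alpha x i 0 + ot_beta x j 0 - M i j) / eta).

Definition ot_obj x : R :=
  eta * (\sum_i \sum_j expR (eta^-1 * (ot_alpha x i 0 + ot_beta x j 0 - M i j)))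
  - dotv (ot_alpha x) a - dotv (ot_beta x) b.

Definition Omega_star : {set 'I_n.+1 * 'I_m} :=
  [set ij | (val ij.1 == 0)%N || (val ij.2 == 0)%N].

Definition sparse_plan (Omega : {set 'I_n.+1 * 'I_m}) x : 'M[R]_(n.+1, m) :=
  \matrix_(i, j) (if (i, j) \in Omega then col' ord_max (ot_plan x) i j else 0).

Definition sparse_hessian (Omega : {set 'I_n.+1 * 'I_m}) x :
    'M[R]_(n.+1 + m) :=
  eta^-1 *: block_mx
    (diag_mx (ot_plan x *m const_mx 1 : 'cV_n.+1)^T) (sparse_plan Omega x)
    (sparse_plan Omega x)^T
    (diag_mx ((col' ord_max (ot_plan x))^T *m const_mx 1 : 'cV_m)^T).

(* The low-rank term, where s and y are the last changes of the iterate and   *)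
(* of the gradient and A is the matrix H_Omega + tau I.                       *)
Definition low_rank (A : 'M[R]_(n.+1 + m)) (s y : 'cV[R]_(n.+1 + m)) :
    'M[R]_(n.+1 + m) :=
  if 10 ^- 6 * enorm y ^+ 2 < dotv y s then
    let v := A *m s in
    (dotv y s)^-1 *: (y *m y^T) + (- (dotv v s)^-1) *: (v *m v^T)
  else 0.

Definition splr_direction (tau_max : R) (Omega : {set 'I_n.+1 * 'I_m})
    (xprev x : 'cV[R]_(n.+1 + m)) : 'cV[R]_(n.+1 + m) :=
  let g := gradient ot_obj x in
  let s := x - xprev in
  let y := g - gradient ot_obj xprev in
  let tau := Num.min tau_max (enorm g) in
  let A := sparse_hessian Omega x + tau%:M in
  let B := A + low_rank A s y in
  - (invmx B *m g).

Definition wolfe (c1 c2 gamma : R) (x d : 'cV[R]_(n.+1 + m)) : Prop :=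
  let xnext := x + gamma *: d in
  ot_obj xnext <= ot_obj x + c1 * gamma * dotv (gradient ot_obj x) d /\
  dotv (gradient ot_obj xnext) d >= c2 * dotv (gradient ot_obj x) d.

(* A relation rather than a function: the scheme Omega and the step size      *)
(* gamma are not determined by xprev and x.                                   *)
Definition splr_step (tau_max c1 c2 : R)
    (xprev x xnext : 'cV[R]_(n.+1 + m)) : Prop :=
  exists (Omega : {set 'I_n.+1 * 'I_m}) (gamma : R),
    let d := splr_direction tau_max Omega xprev x in
    [/\ Omega_star \subset Omega, 0 < gamma, wolfe c1 c2 gamma x d
      & xnext = x + gamma *: d].

End EntropicOT.

(* The iterate before x_(k-1), where xinit is the free choice of x_(-1).      *)
Definition prev_iterate (T : Type) (xinit : T) (x : nat -> T) (k : nat) : T :=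
  if k == 1%N then xinit else x k.-2.

(* Main.v *)
(* Since a and b both have sum 1, the objective separates as the sum over     *)
(* (i, j) of eta exp(q_ij) - a_i b_j (eta q_ij + M_ij), where                 *)
(* q_ij = (alpha_i + beta_j - M_ij) / eta, and each summand is bounded below  *)
(* and coercive in q_ij. Hence f is bounded below, and on a sublevel set all  *)
(* T_ij lie between two positive constants. On this set the gradient is       *)
(* therefore Lipschitz and strongly monotone, and H_Omega is uniformly        *)
(* bounded and positive definite (for any Omega). The rank-two term is a BFGS *)
(* update, with both bounds surviving by the condition on y^T s and strong    *)
(* monotonicity. The Wolfe conditions then give a decrease                    *)
(* f(x+) <= f(x) - kappa |grad f(x)|^2 with a fixed kappa > 0, which the      *)
(* arbitrary points x_k^s preserve, and the decreases are summable. The       *)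
(* sublevel set is chosen to contain x_(-1) as well, so that the first step   *)
(* is not special.                                                            *)

Require Import Defs.
From HB Require Import structures.
From mathcomp Require Import all_boot all_order all_algebra.
From mathcomp Require Import all_classical all_reals all_analysis.
From mathcomp Require Import ring lra.

Set Implicit Arguments.
Unset Strict Implicit.
Unset Printing Implicit Defensive.

Import Order.TTheory GRing.Theory Num.Theory.
Import numFieldNormedType.Exports.

Local Open Scope classical_set_scope.
Local Open Scope ring_scope.

(** This is a Zoutendijk argument made uniform on one sublevel set. There [sublevel_plan_bounds]
    confines every [T_ij] to a fixed interval [[t0, t1]] with [t0 > 0]. The form [pot_sqr], the sum
    of all [(alpha_i + beta_j)^2], is equivalent to the squared norm, because [beta_m = 0] rules out
    shifting a constant between alpha and beta. Gradient increments ([gradient_diff_bounds]) and the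
    sparsified Hessian ([sparse_hessian_bounds]) are both compared with it.

    [low_rank_update_le] and [low_rank_update_ge] carry these bounds over to [B], so by
    [splr_direction_bounds] both [|g|^2] and [|d|^2] are at most a constant times [- g.d]. The Wolfe
    conditions then give [splr_step_descent]. The values of [f] along the iterates are nonincreasing
    and bounded below, so their consecutive differences, which dominate [kappa |g|^2], tend to 0. *)

Lemma dotv_mx (R : realType) p (u v : 'cV[R]_p) : dotv u v = (u^T *m v) 0 0.
Proof. by rewrite mxE; apply: eq_bigr => i _; rewrite mxE. Qed.

Lemma dotv_mulmx (R : realType) p q (A : 'M[R]_(p, q)) u v :
  dotv u (A *m v) = dotv (A^T *m u) v.
Proof. by rewrite !dotv_mx trmx_mul trmxK mulmxA. Qed.

(** * Inner products and quadratic forms *)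

Section EuclideanFacts.
Context {R : realType} {p : nat}.
Implicit Types (u v w : 'cV[R]_p) (A : 'M[R]_p).

Lemma dotvC u v : dotv u v = dotv v u.
Proof. by apply: eq_bigr => i _; rewrite mulrC. Qed.

Lemma dotvDl u v w : dotv (u + v) w = dotv u w + dotv v w.
Proof. by rewrite -big_split; apply: eq_bigr => i _; rewrite mxE mulrDl. Qed.

Lemma dotvZl (k : R) u w : dotv (k *: u) w = k * dotv u w.
Proof. by rewrite mulr_sumr; apply: eq_bigr => i _; rewrite mxE mulrA. Qed.

Lemma dotvDr u v w : dotv w (u + v) = dotv w u + dotv w v.
Proof. by rewrite !(dotvC w) dotvDl. Qed.

Lemma dotvZr (k : R) u w : dotv w (k *: u) = k * dotv w u.
Proof. by rewrite !(dotvC w) dotvZl. Qed.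

Lemma dotvNl u w : dotv (- u) w = - dotv u w.
Proof. by rewrite -scaleN1r dotvZl mulN1r. Qed.

Lemma dotvNr u w : dotv w (- u) = - dotv w u.
Proof. by rewrite !(dotvC w) dotvNl. Qed.

Lemma dotv_ge0 u : 0 <= dotv u u.
Proof. by apply: sumr_ge0 => i _; rewrite -expr2 sqr_ge0. Qed.

Lemma dotv_eq0 u : dotv u u = 0 -> u = 0.
Proof.
move=> /eqP; rewrite psumr_eq0; last by move=> i _; rewrite -expr2 sqr_ge0.
move=> /allP u0; apply/matrixP => i j; rewrite mxE ord1.
by have := u0 i (mem_index_enum i); rewrite mulf_eq0 orbb => /eqP.
Qed.

Lemma sqr_enorm u : enorm u ^+ 2 = dotv u u.
Proof. by rewrite sqr_sqrtr // dotv_ge0. Qed.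

Lemma mul_cV_rV u v w : u *m v^T *m w = dotv v w *: u.
Proof.
apply/matrixP => i j; rewrite ord1 -mulmxA !mxE big_ord1 -dotv_mx.
by rewrite mulrC.
Qed.

Lemma cauchy_schwarz u v : dotv u v ^+ 2 <= dotv u u * dotv v v.
Proof.
have [v0|v0] := eqVneq (dotv v v) 0.
  rewrite (dotv_eq0 v0) -(scale0r (0 : 'cV[R]_p)) !dotvZr !mul0r expr0n /=.
  by rewrite mulr0.
have vgt0 : 0 < dotv v v by rewrite lt_def v0 dotv_ge0.
have := dotv_ge0 (dotv v v *: u - dotv u v *: v).
rewrite !(dotvDl, dotvDr, dotvNl, dotvNr, dotvZl, dotvZr) (dotvC v u) => h.
rewrite -subr_ge0 -(pmulr_rge0 _ vgt0); apply: le_trans h _.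
by rewrite le_eqVlt; apply/orP; left; apply/eqP; ring.
Qed.

(** Serves to pass from [gradient], defined by partial derivatives, to derivatives in all
    directions. *)
Lemma dotv_cV_sum_delta (F : 'cV[R]_p -> R) :
  (forall k u v, F (k *: u + v) = k * F u + F v) ->
  forall u, F u = \sum_i F (delta_mx i 0) * u i 0.
Proof.
move=> FL u.
have F0 : F 0 = 0 by have := FL 1 0 0; rewrite scaler0 addr0 mul1r => h; lra.
rewrite [in LHS](matrix_sum_delta u) (big_morph F (op1 := +%R) (id1 := 0)) //.
  by apply: eq_bigr => i _; rewrite big_ord1 -[_ *: _]addr0 FL F0 addr0 mulrC.
by move=> v w; rewrite -[v]scale1r FL mul1r scale1r.
Qed.

(* Expand the form at [u - lam^-1 A u]. *)
Lemma sqr_norm_mulmx_le A (lam : R) u : A^T = A -> 0 < lam ->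
  (forall w, 0 <= dotv w (A *m w) <= lam * dotv w w) ->
  dotv (A *m u) (A *m u) <= lam * dotv u (A *m u).
Proof.
move=> AT lam0 hA; set w := A *m u.
have /andP[h _] := hA (u - lam^-1 *: w).
have /andP[_ h2] := hA w.
move: h; rewrite mulmxBr -scalemxAr -/w.
rewrite !(dotvDl, dotvDr, dotvNl, dotvNr, dotvZl, dotvZr).
rewrite (dotv_mulmx A u w) AT -/w => h.
rewrite -ler_pdivrMl //.
have h3 : lam^-1 * (lam^-1 * dotv w (A *m w)) <= lam^-1 * dotv w w.
  by rewrite ler_pM2l ?invr_gt0 // ler_pdivrMl.
lra.
Qed.

(** [A] kills every column of its cokernel matrix, so the form vanishes there and the column is
    0. *)
Lemma posdef_unitmx A : (forall u, u != 0 -> 0 < dotv u (A *m u)) ->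
  A \in unitmx.
Proof.
move=> hA; rewrite -row_full_unit -cokermx_eq0; apply/eqP/matrixP => i j.
set B := cokermx A.
have : col j B = 0.
  apply/eqP; apply/negPn/negP => /hA.
  have -> : A *m col j B = 0 by rewrite colE mulmxA mulmx_coker mul0mx.
  by rewrite -(scale0r (0 : 'cV[R]_p)) dotvZr mul0r ltxx.
by move=> /matrixP /(_ i 0); rewrite !mxE.
Qed.

End EuclideanFacts.

(** * The rank-two quasi-Newton update *)

Section QuasiNewtonUpdate.
Context {R : realType} {n m : nat}.
Local Notation vect := 'cV[R]_(n.+1 + m).

Lemma low_rank_form (A : 'M[R]_(n.+1 + m)) (s y z : vect) :
  10 ^- 6 * dotv y y < dotv y s ->
  dotv z (low_rank A s y *m z) =
  dotv y z ^+ 2 / dotv y s - dotv (A *m s) z ^+ 2 / dotv (A *m s) s.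
Proof.
move=> ys; rewrite /low_rank sqr_enorm ys mulmxDl -!scalemxAl !mul_cV_rV.
by rewrite dotvDr !dotvZr !(dotvC z) !expr2; ring.
Qed.

Lemma low_rank_sym (A : 'M[R]_(n.+1 + m)) (s y : vect) :
  (low_rank A s y)^T = low_rank A s y.
Proof.
rewrite /low_rank; case: ifP => _; last by rewrite trmx0.
by rewrite linearD /= !linearZ /= !trmx_mul !trmxK.
Qed.

(** The term in [A s] only lowers the form. By Cauchy-Schwarz the term in [y] is at most
    [|y|^2 / (y.s)] times [|z|^2], and the test in [low_rank] bounds this ratio by [10^6]. *)
Lemma low_rank_update_le (A : 'M[R]_(n.+1 + m)) (lam : R) (s y z : vect) :
  (forall w, 0 <= dotv w (A *m w) <= lam * dotv w w) ->
  dotv z ((A + low_rank A s y) *m z) <= (lam + 10 ^+ 6) * dotv z z.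
Proof.
move=> hA; have /andP[_ hz] := hA z.
have z0 := dotv_ge0 z.
have p6 : 0 < 10 ^+ 6 :> R by rewrite exprn_gt0.
rewrite mulmxDl dotvDr; have [ys|ys] := boolP (10 ^- 6 * dotv y y < dotv y s).
  rewrite low_rank_form //.
  have q0 : 0 < dotv y s.
    by apply: le_lt_trans ys; rewrite mulr_ge0 ?dotv_ge0 // invr_ge0 ltW.
  have h1 : dotv y z ^+ 2 / dotv y s <= 10 ^+ 6 * dotv z z.
    rewrite ler_pdivrMr //; apply: le_trans (cauchy_schwarz y z) _.
    rewrite mulrAC ler_wpM2r //; move: ys; rewrite mulrC ltr_pdivrMr // mulrC.
    exact: ltW.
  have h2 : 0 <= dotv (A *m s) z ^+ 2 / dotv (A *m s) s.
    by rewrite divr_ge0 ?sqr_ge0 // dotvC; case/andP: (hA s).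
  rewrite mulrDl; lra.
rewrite /low_rank sqr_enorm (negbTE ys) mul0mx.
rewrite -(scale0r (0 : vect)) dotvZr mul0r addr0 mulrDl.
by rewrite (le_trans hz) // lerDl mulr_ge0 // ltW.
Qed.

(* Split [z = t s + w] with [w] orthogonal to [s] for the form of [A]. The form
   of the updated matrix is that of [A] at [w], plus [dotv y z ^+ 2 / dotv y s],
   which controls [t]. *)
Lemma low_rank_update_ge (A : 'M[R]_(n.+1 + m)) (mu nu : R) (s y z : vect) :
  A^T = A -> 0 < mu -> 0 < nu ->
  (forall w, mu * dotv w w <= dotv w (A *m w)) ->
  nu * dotv s s <= dotv y s ->
  dotv z z <= (4 / nu + (4 * 10 ^+ 6 / nu + 2) / mu) *
              dotv z ((A + low_rank A s y) *m z).
Proof.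
move=> AT mu0 nu0 hA hs.
have p6 : 0 < 10 ^+ 6 :> R by rewrite exprn_gt0.
set k6 := 10 ^+ 6 in p6 *.
have nuI : 0 < nu^-1 by rewrite invr_gt0.
have muI : 0 < mu^-1 by rewrite invr_gt0.
have hA' w : dotv w w <= mu^-1 * dotv w (A *m w).
  by rewrite ler_pdivlMl.
have Apos w : 0 <= dotv w (A *m w).
  by apply: le_trans (hA w); rewrite mulr_ge0 ?dotv_ge0 // ltW.
rewrite mulmxDl dotvDr; have [ys|ys] := boolP (10 ^- 6 * dotv y y < dotv y s);
  last first.
  rewrite /low_rank sqr_enorm (negbTE ys) mul0mx.
  rewrite -(scale0r (0 : vect)) dotvZr mul0r addr0.
  apply: le_trans (hA' z) _; rewrite ler_wpM2r //.
  have : 0 <= k6 / nu / mu by rewrite !mulr_ge0 // ltW.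
  by rewrite !mulrDl; lra.
rewrite low_rank_form //.
have q0 : 0 < dotv y s.
  by apply: le_lt_trans ys; rewrite mulr_ge0 ?dotv_ge0 // invr_ge0 ltW.
have yy : dotv y y <= k6 * dotv y s.
  by move: ys; rewrite mulrC ltr_pdivrMr // mulrC => /ltW.
set q := dotv y s in q0 hs yy *.
have s0 : 0 < dotv s s.
  rewrite lt_def dotv_ge0 andbT; apply/eqP => /dotv_eq0 s0.
  by move: q0; rewrite /q s0 -(scale0r (0 : vect)) dotvZr mul0r ltxx.
have r0 : 0 < dotv (A *m s) s.
  by rewrite dotvC; apply: lt_le_trans (hA s); rewrite mulr_gt0.
set r := dotv (A *m s) s in r0 *.
(* [t s] is the projection of [z] on [s] for the form of [A]. *)
pose t := dotv (A *m s) z / r; pose w := z - t *: s.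
have zE : z = t *: s + w by rewrite /w addrC subrK.
have tr : dotv (A *m s) z = t * r by rewrite /t divfK // gt_eqF.
have sw : dotv (A *m s) w = 0 by rewrite /w dotvDr dotvNr dotvZr tr subrr.
clearbody w t.
(* Pythagoras: the subtracted rank-one term is exactly the part of the form of [A] along [s]. *)
have wAw : dotv w (A *m w) = dotv z (A *m z) - dotv (A *m s) z ^+ 2 / r.
  rewrite {1 2}zE mulmxDr -scalemxAr !(dotvDl, dotvDr, dotvZl, dotvZr).
  rewrite (dotv_mulmx A s w) AT (dotvC w (A *m s)) sw tr (dotvC s (A *m s)) -/r.
  by field; rewrite gt_eqF.
set Y := dotv y z ^+ 2 / q.
have -> : dotv z (A *m z) + (Y - dotv (A *m s) z ^+ 2 / r) =
          dotv w (A *m w) + Y by rewrite wAw; ring.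
have yz : dotv y z = t * q + dotv y w by rewrite {1}zE dotvDr dotvZr.
have Y0 : 0 <= Y by rewrite divr_ge0 ?sqr_ge0 // ltW.
have ww := dotv_ge0 w.
have yw : dotv y w ^+ 2 / q <= k6 * dotv w w.
  rewrite ler_pdivrMr //; apply: le_trans (cauchy_schwarz y w) _.
  by rewrite mulrAC ler_wpM2r.
have tq : t ^+ 2 * q <= 2 * Y + 2 * (dotv y w ^+ 2 / q).
  rewrite -(ler_pM2r q0) mulrDl -(mulrA 2 Y) -(mulrA 2 (_ / _)) /Y.
  rewrite !divfK ?gt_eqF // yz -subr_ge0.
  apply: le_trans (sqr_ge0 (t * q + 2 * dotv y w)) _.
  by rewrite le_eqVlt; apply/orP; left; apply/eqP; ring.
have ts : t ^+ 2 * dotv s s <= nu^-1 * (t ^+ 2 * q).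
  by rewrite mulrCA ler_wpM2l ?sqr_ge0 // ler_pdivlMl.
have zz : dotv z z <= 2 * (t ^+ 2 * dotv s s) + 2 * dotv w w.
  rewrite -subr_ge0; apply: le_trans (dotv_ge0 (t *: s - w)) _.
  rewrite {1 2}zE !(dotvDl, dotvDr, dotvNl, dotvNr, dotvZl, dotvZr) (dotvC w s).
  by rewrite le_eqVlt; apply/orP; left; apply/eqP; ring.
have tq' : nu^-1 * (t ^+ 2 * q) <= nu^-1 * (2 * Y + 2 * (k6 * dotv w w)).
  by rewrite ler_pM2l //; lra.
have k0 : 0 <= 4 * k6 / nu + 2.
  by rewrite addr_ge0 // mulr_ge0 ?ltW // mulr_gt0.
have ww' : (4 * k6 / nu + 2) * dotv w w
    <= (4 * k6 / nu + 2) * (mu^-1 * dotv w (A *m w)).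
  by rewrite ler_wpM2l.
(* So far [|z|^2] is bounded by [4 / nu] times [Y] plus [(4 k6 / nu + 2) / mu] times the form at
   [w]. The claimed constant is the sum of both coefficients; the cross terms are nonnegative. *)
have e1 : 0 <= nu^-1 * dotv w (A *m w) by rewrite mulr_ge0 // ltW.
have e2 : 0 <= (4 * k6 / nu + 2) / mu * Y.
  by rewrite mulr_ge0 // mulr_ge0 // ltW.
lra.
Qed.

End QuasiNewtonUpdate.

(** * The objective and its gradient *)

Section Objective.
Context {R : realType} {n m : nat}.
Variables (M : 'M[R]_(n.+1, m.+1)) (a : 'cV[R]_n.+1) (b : 'cV[R]_m.+1).
Variable eta : R.
Local Notation vect := 'cV[R]_(n.+1 + m).
Local Notation f := (ot_obj M a b eta).
Local Notation T := (ot_plan M eta).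
Implicit Types x z : vect.

Definition pot_sum z i j : R := ot_alpha z i 0 + ot_beta z j 0.

Lemma ot_alphaZD (k : R) x z :
  ot_alpha (k *: x + z) = k *: ot_alpha x + ot_alpha z.
Proof. by rewrite /ot_alpha linearP. Qed.

Lemma ot_betaZD (k : R) x z : ot_beta (k *: x + z) = k *: ot_beta x + ot_beta z.
Proof.
apply/colP => j; rewrite /ot_beta !mxE; case: unlift => [j'|]; rewrite ?mxE //.
by rewrite mulr0 addr0.
Qed.

Lemma pot_sumZD (k : R) x z i j :
  pot_sum (k *: x + z) i j = k * pot_sum x i j + pot_sum z i j.
Proof. by rewrite /pot_sum ot_alphaZD ot_betaZD !mxE; ring. Qed.

Lemma pot_sumB x z i j : pot_sum (x - z) i j = pot_sum x i j - pot_sum z i j.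
Proof. by rewrite addrC -scaleN1r pot_sumZD; ring. Qed.

Lemma ot_planE x i j : T x i j = expR (eta^-1 * (pot_sum x i j - M i j)).
Proof. by rewrite mxE mulrC. Qed.

(** The derivative of the objective at [x] in direction [z], as an explicit linear form in [z]. *)
Definition ot_diff x z : R :=
  \sum_i \sum_j T x i j * pot_sum z i j
  - dotv (ot_alpha z) a - dotv (ot_beta z) b.

Lemma derive_ot_obj x z : eta != 0 -> 'D_z f x = ot_diff x z.
Proof.
move=> eta0.
pose l := dotv (ot_alpha z) a + dotv (ot_beta z) b.
pose l0 := dotv (ot_alpha x) a + dotv (ot_beta x) b.
(* [F] is the objective on the line [x + h z], built from operations on functions so that instances
   of [is_derive] compute its derivative. *)
pose g i j : R -> R := expR \o ((eta^-1 * pot_sum z i j) \*: id +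
  cst (eta^-1 * (pot_sum x i j - M i j))).
pose F : R -> R := eta \*: (\sum_i \sum_j g i j) - (l \*: id + cst l0).
have FE h : f (h *: z + x) = F h.
  rewrite /F /ot_obj ot_alphaZD ot_betaZD !dotvDl !dotvZl /=.
  rewrite /l /l0 -/(_ \*: _) /= !fctE fct_sumE /=.
  under [in RHS]eq_bigr => i _ do rewrite fct_sumE.
  rewrite /g /= -addrA; congr (_ * _ + _); last first.
    by rewrite /GRing.scale /=; ring.
  apply: eq_bigr => i _; apply: eq_bigr => j _; congr expR.
  rewrite -ot_alphaZD -ot_betaZD -/(pot_sum _ i j) pot_sumZD.
  rewrite -[RHS]/(eta^-1 * pot_sum z i j * h +
                  eta^-1 * (pot_sum x i j - M i j)).
  by ring.
have DF : is_derive (0 : R) (1 : R) F (ot_diff x z).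
  apply: is_derive_eq; rewrite /ot_diff /l scaler_sumr.
  rewrite -[RHS]addrA; congr (_ + _); last first.
    by rewrite /GRing.scale /=; ring.
  apply: eq_bigr => i _; rewrite scaler_sumr; apply: eq_bigr => j _.
  rewrite ot_planE [X in expR X](_ : _ = eta^-1 * (pot_sum x i j - M i j)).
    by rewrite addr0 /GRing.scale /=; field.
  by rewrite -[LHS]/(eta^-1 * pot_sum z i j * 0 + _) mulr0 add0r.
have quotE : (fun h => h^-1 *: ((f \o shift x) (h *: z) - f x)) =
             (fun h => h^-1 *: ((F \o shift 0) (h *: 1) - F 0)).
  apply/funext => h /=; rewrite FE -{1}(add0r x) -(scale0r z) FE.
  by rewrite addr0 /GRing.scale /= mulr1.
by rewrite -(@derive_val _ _ _ _ _ _ _ DF) /derive quotE.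
Qed.

Lemma gradient_dotv x z : eta != 0 -> dotv (gradient f x) z = ot_diff x z.
Proof.
move=> eta0; rewrite [RHS]dotv_cV_sum_delta.
  by apply: eq_bigr => i _; rewrite mxE derive_ot_obj.
move=> k u v; rewrite /ot_diff ot_alphaZD ot_betaZD !dotvDl !dotvZl.
have -> : \sum_i \sum_j T x i j * pot_sum (k *: u + v) i j =
  k * (\sum_i \sum_j T x i j * pot_sum u i j) +
  \sum_i \sum_j T x i j * pot_sum v i j.
  rewrite mulr_sumr -big_split; apply: eq_bigr => i _ /=.
  rewrite mulr_sumr -big_split; apply: eq_bigr => j _ /=.
  by rewrite pot_sumZD; ring.
by ring.
Qed.

End Objective.

(** * Estimates for the exponential *)

Section ExpLinear.
Context {R : realType}.
Implicit Types p q w K t : R.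

Lemma expR_sub_linear_ge0 w q : 0 <= w <= 1 -> 0 <= expR q - w * q.
Proof.
move=> /andP[w0 w1]; have := expR_ge1Dx q; have := expR_ge0 q.
by case: (lerP 0 q) => q0; nra.
Qed.

Lemma expR_sub_linear_coercive w q K : 0 < w <= 1 ->
  expR q - w * q <= K -> `|q| <= K / w + (1 + K).
Proof.
move=> /andP[w0 w1] h.
have K0 : 0 <= K by apply: le_trans h; rewrite expR_sub_linear_ge0 // ltW.
have Kw : 0 <= K / w by rewrite divr_ge0 // ltW.
case: (ger0P q) => q0.
  (* Squaring [1 + q / 2 <= expR (q / 2)] gives quadratic growth, which beats [w q <= q]. *)
  have e2 : expR q = expR (q / 2) * expR (q / 2) by rewrite -expRD -splitr.
  have e1 := expR_ge1Dx (q / 2).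
  have h2 : (1 + q / 2) * (1 + q / 2) <= expR q.
    by rewrite e2 ler_pM //; lra.
  have hw : w * q <= q by rewrite ler_piMl.
  by have := sqr_ge0 (q / 2 - 1); lra.
have : - q <= K / w by rewrite ler_pdivlMr //; have := expR_ge0 q; lra.
lra.
Qed.

(** For [q <= p] the tangent inequality at [q] and at [p] puts [expR p - expR q] between [expR q]
    and [expR p] times [p - q]. *)
Lemma expR_monotone_bounds p q t0 t1 :
  t0 <= expR p <= t1 -> t0 <= expR q <= t1 ->
  t0 * (p - q) ^+ 2 <= (expR p - expR q) * (p - q) <= t1 * (p - q) ^+ 2.
Proof.
wlog pq : p q / q <= p => [H hp hq|].
  case: (lerP q p) => [|/ltW] h; first exact: H.
  have -> : (p - q) ^+ 2 = (q - p) ^+ 2 by ring.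
  have -> : (expR p - expR q) * (p - q) = (expR q - expR p) * (q - p) by ring.
  exact: H.
move=> /andP[_ p1] /andP[q0 _]; set r := p - q.
have r0 : 0 <= r by rewrite subr_ge0.
have e1 : expR q * r <= expR p - expR q.
  have -> : expR p = expR q * expR r by rewrite -expRD addrC subrK.
  by have := ler_wpM2l (expR_ge0 q) (expR_ge1Dx r); lra.
have e2 : expR p - expR q <= expR p * r.
  have -> : expR q = expR p * expR (- r).
    by rewrite -expRD /r opprB addrC subrK.
  by have := ler_wpM2l (expR_ge0 p) (expR_ge1Dx (- r)); lra.
have f1 : t0 * r <= expR q * r by rewrite ler_wpM2r.
have f2 : expR p * r <= t1 * r by rewrite ler_wpM2r.
by rewrite expr2 !mulrA !ler_wpM2r //; lra.
Qed.

End ExpLinear.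

(** * Uniform bounds on gradient increments and on the sparsified Hessian *)

Section Bounds.
Context {R : realType} {n m : nat}.
Variables (M : 'M[R]_(n.+1, m.+1)) (a : 'cV[R]_n.+1) (b : 'cV[R]_m.+1).
Variable eta : R.
Hypothesis eta_gt0 : 0 < eta.
Local Notation vect := 'cV[R]_(n.+1 + m).
Local Notation f := (ot_obj M a b eta).
Local Notation T := (ot_plan M eta).
Implicit Types x z : vect.

(** The quadratic form of the full Hessian with every [T_ij / eta] replaced by 1. *)
Definition pot_sqr z : R := \sum_i \sum_j pot_sum z i j ^+ 2.

(** The linear terms in [a] and [b] cancel, and [expR_monotone_bounds] applies to each entry. Only
    the two endpoints enter, so the segment between them need not be controlled. *)
Lemma gradient_diff_bounds (t0 t1 : R) x z :
  (forall i j, t0 <= T x i j <= t1) -> (forall i j, t0 <= T z i j <= t1) ->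
  t0 / eta * pot_sqr (z - x) <=
    dotv (gradient f z - gradient f x) (z - x) <= t1 / eta * pot_sqr (z - x).
Proof.
move=> Tx Tz; have eta0 : eta != 0 by rewrite gt_eqF.
have -> : dotv (gradient f z - gradient f x) (z - x) =
    \sum_i \sum_j (T z i j - T x i j) * pot_sum (z - x) i j.
  rewrite dotvDl dotvNl !gradient_dotv // /ot_diff.
  under [X in _ = X]eq_bigr => i _ do
    (under eq_bigr => j _ do rewrite mulrBl; rewrite sumrB).
  by rewrite sumrB; ring.
have key i j : t0 / eta * pot_sum (z - x) i j ^+ 2 <=
    (T z i j - T x i j) * pot_sum (z - x) i j <=
    t1 / eta * pot_sum (z - x) i j ^+ 2.
  move: (Tx i j) (Tz i j); rewrite !ot_planE => hx hz.
  have := expR_monotone_bounds hz hx.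
  have -> : eta^-1 * (pot_sum z i j - M i j) - eta^-1 * (pot_sum x i j - M i j)
      = eta^-1 * pot_sum (z - x) i j.
    by rewrite pot_sumB; ring.
  set d := pot_sum _ _ _ => h.
  have E k : k / eta * d ^+ 2 = eta * (k * (eta^-1 * d) ^+ 2) by field.
  have E' k : k * d = eta * (k * (eta^-1 * d)) by field.
  by rewrite !E E' !ler_pM2l.
rewrite /pot_sqr !mulr_sumr; apply/andP; split; apply: ler_sum => i _;
  rewrite mulr_sumr; apply: ler_sum => j _; by case/andP: (key i j).
Qed.

Lemma pot_sum_max z i : pot_sum z i ord_max = usubmx z i 0.
Proof. by rewrite /pot_sum [ot_beta _ _ _]mxE unlift_none addr0. Qed.

Lemma pot_sum_lift z i j :
  pot_sum z i (lift ord_max j) = usubmx z i 0 + dsubmx z j 0.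
Proof. by rewrite /pot_sum [ot_beta _ _ _]mxE liftK. Qed.

Lemma dotv_split x z :
  dotv x z = dotv (usubmx x) (usubmx z) + dotv (dsubmx x) (dsubmx z).
Proof.
rewrite /dotv big_split_ord.
by congr (_ + _); apply: eq_bigr => i _; rewrite !mxE.
Qed.

Lemma sqr_coord_le p (u : 'cV[R]_p) i : u i 0 ^+ 2 <= dotv u u.
Proof.
rewrite /dotv (bigD1 i) //= -expr2 lerDl sumr_ge0 // => j _.
by rewrite -expr2 sqr_ge0.
Qed.

Lemma sqr_usubmx_le z i : usubmx z i 0 ^+ 2 <= dotv z z.
Proof.
by rewrite dotv_split (le_trans (sqr_coord_le _ _)) // lerDl dotv_ge0.
Qed.

Lemma sqr_dsubmx_le z i : dsubmx z i 0 ^+ 2 <= dotv z z.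
Proof.
by rewrite dotv_split (le_trans (sqr_coord_le _ _)) // lerDr dotv_ge0.
Qed.

Lemma sum_lift_max (F : 'I_n.+1 -> 'I_m.+1 -> R) :
  \sum_i \sum_j F i j =
  \sum_i (F i ord_max + \sum_(j < m) F i (lift ord_max j)).
Proof. by apply: eq_bigr => i _; rewrite (bigD1_ord ord_max). Qed.

Lemma pot_sqrE z : pot_sqr z =
  \sum_i (usubmx z i 0 ^+ 2 + \sum_j (usubmx z i 0 + dsubmx z j 0) ^+ 2).
Proof.
rewrite /pot_sqr sum_lift_max; apply: eq_bigr => i _; rewrite pot_sum_max.
by congr (_ + _); apply: eq_bigr => j _; rewrite pot_sum_lift.
Qed.

Lemma pot_sqr_le z : pot_sqr z <= 4 * (n.+1 * m.+1)%:R * dotv z z.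
Proof.
apply: (@le_trans _ _ (\sum_(i < n.+1) \sum_(j < m.+1) 4 * dotv z z)).
  rewrite /pot_sqr !sum_lift_max; apply: ler_sum => i _.
  have h := sqr_usubmx_le z i; have zz := dotv_ge0 z.
  rewrite pot_sum_max lerD //; first by lra.
  apply: ler_sum => j _; rewrite pot_sum_lift; have h' := sqr_dsubmx_le z j.
  by have := sqr_ge0 (usubmx z i 0 - dsubmx z j 0); nra.
under eq_bigr => i _ do rewrite sumr_const card_ord.
by rewrite sumr_const card_ord -mulrnA -mulr_natl natrM le_eqVlt;
   apply/orP; left; apply/eqP; ring.
Qed.

(* [beta_j = (alpha_0 + beta_j) - alpha_0]. *)
Lemma pot_sqr_ge z : dotv z z <= (3 + 2 * m%:R) * pot_sqr z.
Proof.
have nn i : 0 <= usubmx z i 0 ^+ 2 + \sum_j (usubmx z i 0 + dsubmx z j 0) ^+ 2.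
  by rewrite addr_ge0 ?sqr_ge0 // sumr_ge0 // => j _; rewrite sqr_ge0.
have h1 : dotv (usubmx z) (usubmx z) <= pot_sqr z.
  rewrite pot_sqrE; apply: ler_sum => i _; rewrite -expr2 lerDl.
  by rewrite sumr_ge0 // => j _; rewrite sqr_ge0.
have h2 : usubmx z 0 0 ^+ 2 + \sum_j (usubmx z 0 0 + dsubmx z j 0) ^+ 2
    <= pot_sqr z.
  by rewrite pot_sqrE (bigD1 0) //= lerDl sumr_ge0.
have h3 : dotv (dsubmx z) (dsubmx z) <=
   2 * \sum_j (usubmx z 0 0 + dsubmx z j 0) ^+ 2 + 2 * (usubmx z 0 0 ^+ 2 *+ m).
  have -> : usubmx z 0 0 ^+ 2 *+ m = \sum_(j < m) usubmx z 0 0 ^+ 2.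
    by rewrite sumr_const card_ord.
  rewrite !mulr_sumr -big_split /=.
  apply: ler_sum => j _.
  by have := sqr_ge0 (2 * usubmx z 0 0 + dsubmx z j 0); nra.
have h4 : \sum_j (usubmx z 0 0 + dsubmx z j 0) ^+ 2 <= pot_sqr z.
  by apply: le_trans h2; rewrite lerDr sqr_ge0.
have h5 : usubmx z 0 0 ^+ 2 *+ m <= m%:R * pot_sqr z.
  rewrite -mulr_natl ler_wpM2l //; apply: le_trans h2; rewrite lerDl.
  by rewrite sumr_ge0 // => j _; rewrite sqr_ge0.
(* Alpha contributes 1, beta contributes [2 + 2 m]. *)
by rewrite dotv_split; lra.
Qed.

Lemma sparse_hessian_sym (Omega : {set 'I_n.+1 * 'I_m}) x :
  (sparse_hessian M eta Omega x)^T = sparse_hessian M eta Omega x.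
Proof. by rewrite /sparse_hessian linearZ /= tr_block_mx !tr_diag_mx trmxK. Qed.

Lemma dotv_diag_mx p (d u : 'cV[R]_p) :
  dotv u (diag_mx d^T *m u) = \sum_i d i 0 * u i 0 ^+ 2.
Proof. by apply: eq_bigr => i _; rewrite mul_diag_mx !mxE; ring. Qed.

Lemma mulmx_const1 p q (A : 'M[R]_(p, q)) i :
  (A *m const_mx 1 : 'cV_p) i 0 = \sum_j A i j.
Proof.
by rewrite mxE; apply: eq_bigr => j _; rewrite [const_mx _ _ _]mxE mulr1.
Qed.

(** The diagonal blocks hold full row and column sums of [T]. Distributed over the entries, they
    give each [T_ij] with [j < m] the factor [(u_i + v_j)^2] if it is kept and [u_i^2 + v_j^2] if it
    is dropped. *)
Lemma sparse_hessian_form (Omega : {set 'I_n.+1 * 'I_m}) x z :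
  dotv z (sparse_hessian M eta Omega x *m z) =
  eta^-1 * \sum_i (T x i ord_max * usubmx z i 0 ^+ 2 +
    \sum_j T x i (lift ord_max j) * (usubmx z i 0 ^+ 2 + dsubmx z j 0 ^+ 2 +
      2 * ((i, j) \in Omega)%:R * (usubmx z i 0 * dsubmx z j 0))).
Proof.
rewrite -scalemxAl dotvZr; congr (_ * _).
rewrite -{2}[z]vsubmxK mul_block_col dotv_split col_mxKu col_mxKd !dotvDr.
move: (usubmx z) (dsubmx z) => u v.
have e1 : dotv u (diag_mx (T x *m const_mx 1 : 'cV_n.+1)^T *m u) =
    \sum_i (T x i ord_max * u i 0 ^+ 2 +
      \sum_j T x i (lift ord_max j) * u i 0 ^+ 2).
  rewrite dotv_diag_mx; apply: eq_bigr => i _.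
  by rewrite mulmx_const1 (bigD1_ord ord_max) //= mulrDl mulr_suml.
have e2 : dotv u (sparse_plan M eta Omega x *m v) =
    \sum_i \sum_j T x i (lift ord_max j) *
      (((i, j) \in Omega)%:R * (u i 0 * v j 0)).
  apply: eq_bigr => i _; rewrite mxE mulr_sumr; apply: eq_bigr => j _.
  rewrite [sparse_plan _ _ _ _ _ _]mxE [col' _ _ _ _]mxE.
  by case: (_ \in _) => /=; ring.
have e3 : dotv v ((sparse_plan M eta Omega x)^T *m u) =
    dotv u (sparse_plan M eta Omega x *m v).
  by rewrite dotvC -dotv_mulmx.
have e4 :
    dotv v (diag_mx ((col' ord_max (T x))^T *m const_mx 1 : 'cV_m)^T *m v) =
    \sum_i \sum_j T x i (lift ord_max j) * v j 0 ^+ 2.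
  rewrite dotv_diag_mx exchange_big; apply: eq_bigr => j _.
  rewrite mulmx_const1 mulr_suml; apply: eq_bigr => i _.
  by rewrite [_^T _ _]mxE mxE.
rewrite e3 e1 e2 e4 -!big_split /=; apply: eq_bigr => i _.
rewrite -!addrA; congr (_ + _); rewrite -!big_split /=; apply: eq_bigr => j _.
by ring.
Qed.

(** Kept or dropped, an entry has a factor of at least [(u_i + v_j)^2 / 2], whence the loss of 2,
    and at most [2 (u_i^2 + v_j^2)]. *)
Lemma sparse_hessian_bounds (Omega : {set 'I_n.+1 * 'I_m}) (t0 t1 : R) x z :
  0 <= t0 -> (forall i j, t0 <= T x i j <= t1) ->
  t0 / eta / 2 * pot_sqr z <= dotv z (sparse_hessian M eta Omega x *m z)
    <= t1 / eta * (4 * (n.+1 * m.+1)%:R * dotv z z).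
Proof.
move=> t00 hT; rewrite sparse_hessian_form.
have etaV : 0 <= eta^-1 by rewrite invr_ge0 ltW.
have zz := dotv_ge0 z.
apply/andP; split.
  have -> : t0 / eta / 2 * pot_sqr z = eta^-1 * (t0 / 2 * pot_sqr z) by ring.
  rewrite ler_wpM2l // pot_sqrE mulr_sumr; apply: ler_sum => i _.
  rewrite mulrDr lerD //.
    have /andP[h _] := hT i ord_max; rewrite ler_wpM2r ?sqr_ge0 //; lra.
  rewrite mulr_sumr; apply: ler_sum => j _.
  have /andP[h _] := hT i (lift ord_max j).
  set u := usubmx z i 0; set v := dsubmx z j 0.
  apply: (@le_trans _ _ (t0 * ((u + v) ^+ 2 / 2))).
    by rewrite le_eqVlt; apply/orP; left; apply/eqP; ring.
  have := sqr_ge0 (u + v); have := sqr_ge0 (u - v) => p1 p2.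
  by rewrite ler_pM //; [lra | case: (_ \in _) => /=; nra].
have -> : t1 / eta * (4 * (n.+1 * m.+1)%:R * dotv z z) =
    eta^-1 * (\sum_(i < n.+1) \sum_(j < m.+1) t1 * (4 * dotv z z)).
  under eq_bigr => i _ do rewrite sumr_const card_ord.
  by rewrite sumr_const card_ord -mulrnA -mulr_natl natrM; ring.
rewrite ler_wpM2l // sum_lift_max; apply: ler_sum => i _.
have h1 := sqr_usubmx_le z i.
apply: lerD.
  have /andP[h h'] := hT i ord_max.
  by rewrite ler_pM // ?sqr_ge0 //; lra.
apply: ler_sum => j _; have /andP[h h'] := hT i (lift ord_max j).
have h2 := sqr_dsubmx_le z j.
set u := usubmx z i 0 in h1 *; set v := dsubmx z j 0 in h2 *.
have p1 := sqr_ge0 (u + v); have p2 := sqr_ge0 (u - v).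
have q1 := sqr_ge0 u; have q2 := sqr_ge0 v.
by rewrite ler_pM //; [lra| |]; case: (_ \in _) => /=; nra.
Qed.

End Bounds.

(** * Separation of the objective and its sublevel sets *)

Section Sublevel.
Context {R : realType} {n m : nat}.
Variables (M : 'M[R]_(n.+1, m.+1)) (a : 'cV[R]_n.+1) (b : 'cV[R]_m.+1).
Variable eta : R.
Hypotheses (eta_gt0 : 0 < eta).
Hypotheses (a_gt0 : forall i, 0 < a i 0) (b_gt0 : forall j, 0 < b j 0).
Hypotheses (sum_a : \sum_i a i 0 = 1) (sum_b : \sum_j b j 0 = 1).
Local Notation vect := 'cV[R]_(n.+1 + m).
Local Notation f := (ot_obj M a b eta).
Local Notation T := (ot_plan M eta).
Implicit Types x z : vect.

(** [logT] is the logarithm of [T], and [cost] is the transport cost of the product coupling of [a]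
    and [b]. *)
Let logT x i j := eta^-1 * (pot_sum x i j - M i j).
Let cost := \sum_i \sum_j a i 0 * b j 0 * M i j.

Lemma weight_bounds i j : 0 < a i 0 * b j 0 <= 1.
Proof.
have le1 p (c : 'cV[R]_p) k :
    (forall i, 0 < c i 0) -> \sum_i c i 0 = 1 -> c k 0 <= 1.
  by move=> c0 <-; rewrite (bigD1 k) //= lerDl sumr_ge0 // => l _; rewrite ltW.
rewrite mulr_gt0 //=; apply: mulr_ile1; first [exact: ltW | exact: le1].
Qed.

(* As [sum a = sum b = 1], both linear terms are double sums with the weights
   [a_i b_j], so that the objective separates in the [alpha_i + beta_j]. *)
Lemma ot_obj_separable x :
  f x + cost = eta * \sum_i \sum_j (T x i j - a i 0 * b j 0 * logT x i j).
Proof.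
have ea : dotv (ot_alpha x) a = \sum_i \sum_j a i 0 * b j 0 * ot_alpha x i 0.
  apply: eq_bigr => i _; rewrite -mulr_suml -mulr_sumr sum_b mulr1.
  by rewrite mulrC.
have eb : dotv (ot_beta x) b = \sum_i \sum_j a i 0 * b j 0 * ot_beta x j 0.
  rewrite exchange_big; apply: eq_bigr => j _; rewrite -mulr_suml -mulr_suml.
  by rewrite sum_a mul1r mulrC.
rewrite /ot_obj ea eb /cost !mulr_sumr -!sumrB -big_split.
apply: eq_bigr => i _.
rewrite !mulr_sumr -!sumrB -big_split; apply: eq_bigr => j _ /=.
rewrite ot_planE /logT /pot_sum mulrBr.
have eta0 : eta != 0 by rewrite gt_eqF.
by field.
Qed.

Lemma separable_term_ge0 x i j : 0 <= T x i j - a i 0 * b j 0 * logT x i j.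
Proof.
rewrite ot_planE; apply: expR_sub_linear_ge0.
by have /andP[h ->] := weight_bounds i j; rewrite ltW.
Qed.

Lemma ot_obj_ge x : - cost <= f x.
Proof.
rewrite -subr_ge0 opprK ot_obj_separable mulr_ge0 ?(ltW eta_gt0) //.
by do 2![apply: sumr_ge0 => ? _]; exact: separable_term_ge0.
Qed.

(** All separated terms are nonnegative, so each one alone is at most [(f0 + cost) / eta], and
    coercivity bounds its exponent. *)
Lemma sublevel_plan_bounds (f0 : R) : exists t0 t1 : R,
  [/\ 0 < t0, 0 < t1 & forall x, f x <= f0 -> forall i j, t0 <= T x i j <= t1].
Proof.
(* The absolute value keeps [K] nonnegative even when the sublevel set is empty. *)
pose K := `|eta^-1 * (f0 + cost)|.
pose Q i j : R := K / (a i 0 * b j 0) + (1 + K).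
have Q0 i j : 0 <= Q i j.
  have /andP[w0 _] := weight_bounds i j; apply: addr_ge0.
    by apply: divr_ge0; [exact: normr_ge0 | exact: ltW].
  by apply: addr_ge0 => //; exact: normr_ge0.
(* The sum stands in for the maximum of the [Q i j]. *)
pose B := \sum_i \sum_j Q i j.
exists (expR (- B)), (expR B); split; rewrite ?expR_gt0 // => x fx i j.
rewrite ot_planE !ler_expR -ler_norml.
apply: (@le_trans _ _ (Q i j)); last first.
  rewrite /B (bigD1 i) //= (bigD1 j) //= -addrA lerDl addr_ge0 //.
    by apply: sumr_ge0 => ? _.
  by do 2![apply: sumr_ge0 => ? _].
apply: expR_sub_linear_coercive; first exact: weight_bounds.
apply: le_trans (ler_norm _); rewrite ler_pdivlMl //.
apply: (@le_trans _ _ (f x + cost)); last by rewrite lerD2r.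
rewrite ot_obj_separable ler_pM2l // -ot_planE.
rewrite (bigD1 i) //= (bigD1 j) //= -addrA lerDl addr_ge0 //.
  by apply: sumr_ge0 => ? _; exact: separable_term_ge0.
by do 2![apply: sumr_ge0 => ? _]; exact: separable_term_ge0.
Qed.

(** * Sufficient decrease in one step *)

Variables (tau_max c1 c2 : R).
Hypotheses (tau_max_gt0 : 0 < tau_max) (c1_gt0 : 0 < c1) (c2_lt1 : c2 < 1).

(** Since [g = B (- d)], the number [- g.d] is the form of [B] at [d]; its lower bound controls
    [|d|^2], its upper bound [|B d|^2 = |g|^2]. *)
Lemma splr_direction_bounds (f0 : R) : exists lam C : R, [/\ 0 < lam, 0 < C &
  forall (Omega : {set 'I_n.+1 * 'I_m}) xprev x, f xprev <= f0 -> f x <= f0 ->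
  let g := gradient f x in
  let d := splr_direction M a b eta tau_max Omega xprev x in
  dotv g g <= lam * - dotv g d /\ dotv d d <= C * - dotv g d].
Proof.
have [t0 [t1 [t0_gt0 t1_gt0 hT]]] := sublevel_plan_bounds f0.
have m0 : 0 < 3 + 2 * m%:R :> R by rewrite ltr_pwDl // mulr_ge0.
(* [mu] and [lamA] bound the form of [H_Omega + tau I] from below and above; [nu] is the strong
   monotonicity constant of the gradient. *)
pose mu := t0 / eta / 2 / (3 + 2 * m%:R).
have mu_gt0 : 0 < mu by rewrite !divr_gt0.
pose nu := t0 / eta / (3 + 2 * m%:R).
have nu_gt0 : 0 < nu by rewrite !divr_gt0.
pose lamA := t1 / eta * (4 * (n.+1 * m.+1)%:R) + tau_max.
have lamA_gt0 : 0 < lamA by rewrite addr_gt0 // mulr_gt0 ?divr_gt0 // mulr_gt0.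
have p6 : 0 < 10 ^+ 6 :> R by rewrite exprn_gt0.
pose C : R := 4 / nu + (4 * 10 ^+ 6 / nu + 2) / mu.
have C_gt0 : 0 < C.
  by rewrite addr_gt0 // divr_gt0 // addr_gt0 // divr_gt0 // mulr_gt0.
exists (lamA + 10 ^+ 6), C; split; [exact: addr_gt0 | exact: C_gt0 |].
move=> Omega xprev x fp fx.
rewrite /splr_direction; set g := gradient f x.
set s := x - xprev; set y := g - gradient f xprev.
set tau := Num.min _ _; set A := _ + tau%:M; set B := A + low_rank A s y.
have tau_ge0 : 0 <= tau by rewrite le_min ltW // sqrtr_ge0.
have tau_le : tau <= tau_max by rewrite ge_min lexx.
have AT : A^T = A by rewrite linearD /= sparse_hessian_sym tr_scalar_mx.
have BT : B^T = B by rewrite linearD /= AT low_rank_sym.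
have hA w : mu * dotv w w <= dotv w (A *m w) <= lamA * dotv w w.
  have /andP[h1 h2] :=
    sparse_hessian_bounds eta_gt0 Omega w (ltW t0_gt0) (hT x fx).
  have ww := dotv_ge0 w; have tw := ler_wpM2r ww tau_le.
  rewrite mulmxDl dotvDr mul_scalar_mx dotvZr; apply/andP; split; last first.
    by rewrite /lamA mulrDl; apply: lerD => //; rewrite -mulrA.
  apply: ler_wpDr; first by rewrite mulr_ge0.
  apply: le_trans h1; rewrite /mu -mulrA ler_pM2l ?divr_gt0 //.
  by rewrite ler_pdivrMl // pot_sqr_ge.
have hs : nu * dotv s s <= dotv y s.
  have /andP[h _] := gradient_diff_bounds a b eta_gt0 (hT _ fp) (hT _ fx).
  apply: le_trans h; rewrite /nu -mulrA ler_pM2l ?divr_gt0 //.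
  by rewrite ler_pdivrMl // pot_sqr_ge.
have Bge w : dotv w w <= C * dotv w (B *m w).
  by apply: low_rank_update_ge => // v; case/andP: (hA v).
have Ble w : 0 <= dotv w (B *m w) <= (lamA + 10 ^+ 6) * dotv w w.
  rewrite -(pmulr_rge0 _ C_gt0) (le_trans (dotv_ge0 w)) //=.
  apply: low_rank_update_le => v; case/andP: (hA v) => h ->; rewrite andbT.
  by apply: le_trans h; rewrite mulr_ge0 ?dotv_ge0 // ltW.
(* [invmx] returns a singular matrix unchanged, so invertibility is needed for [d] to solve
   [B d = - g]. *)
have Bunit : B \in unitmx.
  apply: posdef_unitmx => u u0; rewrite -(pmulr_rgt0 _ C_gt0).
  apply: lt_le_trans (Bge u); rewrite lt_def dotv_ge0 andbT.
  by apply: contra u0 => /eqP /dotv_eq0 ->.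
set d := - (invmx B *m g).
have Bd : g = B *m - d by rewrite opprK mulKVmx.
have -> : - dotv g d = dotv (- d) (B *m - d) by rewrite -Bd dotvNl (dotvC d).
split; last by have := Bge (- d); rewrite [dotv _ (- d)]dotvNr dotvNl opprK.
rewrite {1 2}Bd; apply: sqr_norm_mulmx_le BT _ Ble; exact: addr_gt0.
Qed.

(* The curvature condition and the Lipschitz bound on the gradient bound the
   step size from below by [(1 - c2) / (L C)]. *)
Lemma splr_step_descent (f0 : R) : exists2 kappa : R, 0 < kappa &
  forall xprev x xnext, f xprev <= f0 -> f x <= f0 ->
  splr_step M a b eta tau_max c1 c2 xprev x xnext ->
  f xnext <= f x - kappa * dotv (gradient f x) (gradient f x).
Proof.
have [t0 [t1 [t0_gt0 t1_gt0 hT]]] := sublevel_plan_bounds f0.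
have [lam [C [lam_gt0 C_gt0 hd]]] := splr_direction_bounds f0.
pose L := t1 / eta * (4 * (n.+1 * m.+1)%:R).
have L_gt0 : 0 < L by rewrite mulr_gt0 ?divr_gt0 ?mulr_gt0.
have c2' : 0 < 1 - c2 by rewrite subr_gt0.
(* Armijo factor, times the lower bound on the step size, times the ratio of [- g.d] to [|g|^2]. *)
exists (c1 * ((1 - c2) / (L * C)) / lam).
  by rewrite divr_gt0 // mulr_gt0 // divr_gt0 // mulr_gt0.
move=> xprev x xnext fp fx [Om [gamma [_ gamma_gt0 [armijo curv] xE]]].
have [] := hd Om xprev x fp fx; rewrite /=.
move: armijo curv xE; set d := splr_direction _ _ _ _ _ _ _ _.
rewrite /= => armijo curv xE; rewrite -xE in armijo curv.
move: armijo curv; set g := gradient f x; set D := dotv g d.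
move=> armijo curv hg hdd.
have D_ge0 : 0 <= - D.
  by rewrite -(pmulr_rge0 _ lam_gt0) (le_trans (dotv_ge0 g)).
(* Armijo keeps the new point in the sublevel set, where the Lipschitz bound holds. *)
have fx' : f xnext <= f0.
  apply: le_trans armijo _; apply: le_trans fx; rewrite gerDl.
  by rewrite mulr_ge0_le0 // -?oppr_ge0 // mulr_ge0 // ltW.
have lip : dotv (gradient f xnext - g) d <= L * gamma * (C * - D).
  have /andP[_] := gradient_diff_bounds a b eta_gt0 (hT _ fx) (hT _ fx').
  rewrite -/g; have -> : xnext - x = gamma *: d by rewrite xE addrC addKr.
  rewrite dotvZr => h.
  rewrite -(ler_pM2l gamma_gt0); apply: le_trans h _.
  apply: (@le_trans _ _ (L * dotv (gamma *: d) (gamma *: d))).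
    by rewrite /L -(mulrA (t1 / eta)) ler_pM2l ?divr_gt0 // pot_sqr_le.
  rewrite dotvZl dotvZr.
  have -> : L * (gamma * (gamma * dotv d d)) = L * gamma * gamma * dotv d d.
    by ring.
  have -> : gamma * (L * gamma * (C * - D)) = L * gamma * gamma * (C * - D).
    by ring.
  by rewrite (ler_pM2l (mulr_gt0 (mulr_gt0 L_gt0 gamma_gt0) gamma_gt0)).
(* Keeping the factor [- D] avoids a separate case for [D = 0]. *)
have gamma_ge : (1 - c2) / (L * C) * - D <= gamma * - D.
  rewrite mulrAC (ler_pdivrMr _ _ (mulr_gt0 L_gt0 C_gt0)).
  have -> : gamma * - D * (L * C) = L * gamma * (C * - D) by ring.
  apply: le_trans lip; rewrite dotvDl dotvNl -/D; lra.
have hg' : dotv g g / lam <= - D by rewrite ler_pdivrMr // mulrC.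
move: gamma_ge; set k := (1 - c2) / (L * C); move=> gamma_ge.
have k_gt0 : 0 < k := divr_gt0 c2' (mulr_gt0 L_gt0 C_gt0).
apply: le_trans armijo _; rewrite lerD2l lerNr.
have -> : - (c1 * gamma * D) = c1 * (gamma * - D) by ring.
have -> : c1 * k / lam * dotv g g = c1 * (k * (dotv g g / lam)) by ring.
by rewrite ler_pM2l //; apply: le_trans gamma_ge; rewrite ler_pM2l.
Qed.

End Sublevel.

(** * Convergence of the gradients along the iterates *)

Theorem theorem5p1 (R : realType) (n m : nat)
  (M : 'M[R]_(n.+1, m.+1)) (a : 'cV[R]_n.+1) (b : 'cV[R]_m.+1) (eta : R)
  (eta_gt0 : 0 < eta)
  (a_gt0 : forall i, 0 < a i 0) (b_gt0 : forall j, 0 < b j 0)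
  (sum_a : \sum_i a i 0 = 1) (sum_b : \sum_j b j 0 = 1)
  (tau_max c1 c2 : R) (tau_max_gt0 : 0 < tau_max)
  (c1_gt0 : 0 < c1) (c1_lt : c1 < 1 / 2) (c12 : c1 < c2) (c2_lt1 : c2 < 1)
  (S : nat) (S_ge2 : (2 <= S)%N)
  (xinit : 'cV[R]_(n.+1 + m)) (x : nat -> 'cV[R]_(n.+1 + m))
  (x_splr : forall k : nat, (1 <= k)%N -> ~~ (S %| k)%N ->
     splr_step M a b eta tau_max c1 c2
       (prev_iterate xinit x k) (x k.-1) (x k))
  (x_mixed : forall k : nat, (1 <= k)%N -> (S %| k)%N ->
     exists xq xs : 'cV[R]_(n.+1 + m),
       splr_step M a b eta tau_max c1 c2
         (prev_iterate xinit x k) (x k.-1) xq /\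
       x k = if ot_obj M a b eta xs <= ot_obj M a b eta xq then xs else xq) :
  (fun k => enorm (gradient (ot_obj M a b eta) (x k))) @ \oo --> (0 : R).
Proof.
pose f := ot_obj M a b eta; pose g k := gradient f (x k).
pose f0 := Num.max (f (x 0%N)) (f xinit).
have [kappa kappa_gt0 descent] := splr_step_descent M eta_gt0 a_gt0 b_gt0 sum_a
  sum_b tau_max_gt0 c1_gt0 c2_lt1 f0.
have step k : f (prev_iterate xinit x k.+1) <= f0 -> f (x k) <= f0 ->
    f (x k.+1) <= f (x k) - kappa * dotv (g k) (g k).
  move=> fp fx; have [Sk|Sk] := boolP (S %| k.+1)%N; last first.
    exact: (descent _ _ _ fp fx (x_splr _ _ Sk)).
  have [xq [xs [hq ->]]] := x_mixed k.+1 isT Sk.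
  have hd := descent _ _ _ fp fx hq.
  by case: ifP => // h; apply: le_trans h hd.
have gg k : 0 <= kappa * dotv (g k) (g k) by rewrite mulr_ge0 ?dotv_ge0 // ltW.
(* The previous iterate is carried along because the descent bound needs both points in the sublevel
   set; it is [xinit] for [k = 0] and the iterate of index [k - 1] afterwards. *)
have bounded k : f (x k) <= f0 /\ f (prev_iterate xinit x k.+1) <= f0.
  elim: k => [|k [IH1 IH2]].
    by rewrite /prev_iterate /= !le_max !lexx orbT.
  split; last by rewrite /prev_iterate.
  apply: le_trans (step k IH2 IH1) _; apply: le_trans IH1.
  by rewrite gerDl oppr_le0.
have decr k : f (x k.+1) <= f (x k) - kappa * dotv (g k) (g k).
  by have [h1 h2] := bounded k; exact: step.
have fcvg : cvgn (f \o x).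
  apply: nonincreasing_is_cvgn.
    apply/nonincreasing_seqP => k /=; apply: le_trans (decr k) _.
    by rewrite gerDl oppr_le0.
  exists (- \sum_i \sum_j a i 0 * b j 0 * M i j) => _ [k _ <-].
  exact: ot_obj_ge.
(* Both [f (x k)] and its shift converge to the same limit. *)
have diff0 : (fun k => kappa^-1 * (f (x k) - f (x k.+1))) @ \oo --> (0 : R).
  rewrite -(mulr0 kappa^-1) -(subrr (limn (f \o x))).
  apply: cvgMr; apply: cvgB; first exact: fcvg.
  by rewrite (cvg_shiftS (f \o x)).
have sq0 : (fun k => dotv (g k) (g k)) @ \oo --> (0 : R).
  apply: (squeeze_cvgr _ (cvg_cst 0) diff0).
  near=> k; rewrite dotv_ge0 /= ler_pdivlMl //.
  by have := decr k; lra.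
rewrite -(sqrtr0 R); apply: (cvg_comp _ _ sq0); exact: sqrt_continuous.
Unshelve. all: by end_near.
Qed.
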